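(* Let $P\in\mathcal{W}_\kappa(\mathcal{Y},\mathcal{E})$. There exists a $\kappa$-compatible Markov embedding $\Lambda^{(P)}_\star$ such that $P=\Lambda^{(P)}_\star\kappa_\star P$. Moreover, $\Lambda^{(P)}_\star$ is induced from $\Lambda^{(P)}\in\mathcal{F}_+(\mathcal{Y},\mathcal{E})$ given by $$\Lambda^{(P)}(y,y')=\frac{P(y,y')}{\kappa_\star P(\kappa(y),\kappa(y'))}\quad\text{for any }(y,y')\in\mathcal{E}.$$
   Context: All vertex sets are finite with at least two elements. $(\mathcal{Y},\mathcal{E})$ is a strongly connected digraph and $\kappa\colon\mathcal{Y}\to\mathcal{X}$ is a surjective map (lumping function); $\mathcal{S}_x=\kappa^{-1}(\{x\})$, $\kappa_2(y,y')=(\kappa(y),\kappa(y'))$, $\mathcal{D}=\kappa_2(\mathcal{E})$. $\mathcal{F}_+(\mathcal{Y},\mathcal{E})$ is the set of functions $\mathcal{Y}^2\to\mathbb{R}$ strictly positive on $\mathcal{E}$ and zero outside; $\mathcal{W}(\mathcal{Y},\mathcal{E})$ is the set of $P\in\mathcal{F}_+(\mathcal{Y},\mathcal{E})$ whose rows sum to $1$. $P\in\mathcal{W}(\mathcal{Y},\mathcal{E})$ is $\kappa$-lumpable if $\sum_{y'\in\mathcal{S}_{x'}}P(y_1,y')=\sum_{y'\in\mathcal{S}_{x'}}P(y_2,y')$ for all $x,x'\in\mathcal{X}$, $y_1,y_2\in\mathcal{S}_x$; the common value is denoted $\kappa_\star P(x,x')$, and $\kappa_\star P\in\mathcal{W}(\mathcal{X},\mathcal{D})$.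 $\mathcal{W}_\kappa(\mathcal{Y},\mathcal{E})$ is the set of $\kappa$-lumpable elements of $\mathcal{W}(\mathcal{Y},\mathcal{E})$. $\kappa$-compatible Markov embedding: a map $\Lambda_\star\colon\mathcal{W}(\mathcal{X},\mathcal{D})\to\mathcal{W}(\mathcal{Y},\mathcal{E})$, $\Lambda_\star\bar P(y,y')=\bar P(\kappa(y),\kappa(y'))\Lambda(y,y')$ for $(y,y')\in\mathcal{E}$ (and $0$ otherwise), where for every $(x,x')\in\mathcal{D}$ and $y\in\mathcal{S}_x$ there is $y'\in\mathcal{S}_{x'}$ with $(y,y')\in\mathcal{E}$; $\Lambda\in\mathcal{F}_+(\mathcal{Y},\mathcal{E})$; and for all $y\in\mathcal{Y}$, $x'\in\mathcal{X}$ with $(\kappa(y),x')\in\mathcal{D}$, $(\Lambda(y,y'))_{y'\in\mathcal{S}_{x'}}$ is a probability distribution on $\mathcal{S}_{x'}$. *)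

(* Defs.v *)
From HB Require Import structures.
From mathcomp Require Import all_boot all_order all_algebra.
From mathcomp Require Import reals.

Set Implicit Arguments.
Unset Strict Implicit.
Unset Printing Implicit Defensive.

Import Order.TTheory GRing.Theory Num.Theory.
Local Open Scope ring_scope.

(* A digraph on V is its set of edges E : {set V * V}; self-loops are allowed. *)
Definition strongly_connected (V : finType) (E : {set V * V}) : Prop :=
  forall u v : V, connect (fun a b => (a, b) \in E) u v.

Section Chains.
Variables (R : realType) (V : finType).
Implicit Types (E : {set V * V}) (f : {ffun V * V -> R}).

Definition Fplus E : {pred {ffun V * V -> R}} :=
  [pred f : {ffun V * V -> R} |
    [forall e, if e \in E then 0 < f e else f e == 0]].

Definition stochastic E : {pred {ffun V * V -> R}} :=
  [pred f | (f \in Fplus E) && [forall u, \sum_v f (u, v) == 1]].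

(* The set W(V, E), as a subtype of the functions V^2 -> R. *)
Record chain E := Chain {
  chain_fun :> {ffun V * V -> R};
  _ : chain_fun \in stochastic E }.

HB.instance Definition _ E := [isSub for @chain_fun E].

End Chains.

Arguments Fplus R {V} E.
Arguments stochastic R {V} E.
Arguments chain R {V} E.

Section Lumping.
Variables (R : realType) (Y X : finType) (kappa : Y -> X).
Implicit Types (E : {set Y * Y}).

Definition surjective : Prop := forall x, exists y, kappa y = x.

Definition fiber (x : X) : {set Y} := kappa @^-1: [set x].

Definition kappa2 (e : Y * Y) : X * X := (kappa e.1, kappa e.2).

Definition lumped_edges E : {set X * X} := kappa2 @: E.

Definition lumpable E (P : chain R E) : Prop :=
  forall x x' y1 y2, y1 \in fiber x -> y2 \in fiber x ->
    \sum_(y' in fiber x') P (y1, y') = \sum_(y' in fiber x') P (y2, y').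

(* The common value is read off at some point of the fiber of x; by lump_funE
   the choice of the point is irrelevant when P is lumpable. *)
Definition lump_fun E (P : chain R E) : {ffun X * X -> R} :=
  [ffun e => if [pick y in fiber e.1] is Some y
             then \sum_(y' in fiber e.2) P (y, y') else 0].

Lemma in_fiber x y : (y \in fiber x) = (kappa y == x).
Proof. by rewrite !inE. Qed.

Lemma lump_funE E (P : chain R E) : lumpable P ->
  forall x x' y, y \in fiber x ->
    lump_fun P (x, x') = \sum_(y' in fiber x') P (y, y').
Proof.
move=> hP x x' y yx; rewrite ffunE /=; case: pickP => [z zx|/(_ y)].
  exact: hP zx yx.
by rewrite yx.
Qed.

Lemma lump_fun_stochastic E (P : chain R E) :
  surjective -> lumpable P -> lump_fun P \in stochastic R (lumped_edges E).
Proof.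
move=> ks hP; have /andP[/forallP Ppos /forallP Psum] : val P \in stochastic R E
  by exact: valP.
have P0 e : 0 <= P e.
  by have /= := Ppos e; case: ifP => _; [exact: ltW | move/eqP->].
apply/andP; split; apply/forallP => /=.
- move=> [x x']; case: ifPn => [/imsetP[[y y'] eE [-> ->]]|nD].
    rewrite (lump_funE hP _ (y := y)) ?in_fiber //= (bigD1 y') ?in_fiber //=.
    apply: ltr_pwDl; last exact: sumr_ge0.
    by have /= := Ppos (y, y'); rewrite eE.
  have [y yx] := ks x; rewrite (lump_funE hP _ (y := y)) ?in_fiber ?yx //.
  rewrite big1 // => y'; rewrite in_fiber => /eqP y'x'.
  have /= := Ppos (y, y'); case: ifP => [eE|_ /eqP //].
  by case/negP: nD; apply/imsetP; exists (y, y') => //; rewrite /kappa2 yx y'x'.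
- move=> x; have [y yx] := ks x.
  under eq_bigr do rewrite (lump_funE hP _ (y := y)) ?in_fiber ?yx //.
  rewrite -(eqP (Psum y)) (partition_big kappa xpredT) //=.
  by apply/eqP/eq_bigr => x' _; apply: eq_bigl => y'; rewrite in_fiber.
Qed.

(* The push-forward of a lumpable chain, as an element of W(X, D). *)
Definition kappa_star E (P : chain R E) (ks : surjective) (hP : lumpable P) :
  chain R (lumped_edges E) := Chain (lump_fun_stochastic ks hP).

Definition prob_dist (S : {set Y}) (q : Y -> R) : Prop :=
  (forall y, y \in S -> 0 <= q y) /\ \sum_(y in S) q y = 1.

Definition embedding_induced_by E (L : {ffun Y * Y -> R})
    (Ls : chain R (lumped_edges E) -> chain R E) : Prop :=
  [/\ forall x x' y, (x, x') \in lumped_edges E -> y \in fiber x ->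
        exists2 y', y' \in fiber x' & (y, y') \in E,
      L \in Fplus R E,
      forall y x', (kappa y, x') \in lumped_edges E ->
        prob_dist (fiber x') (fun y' => L (y, y'))
    & forall (Q : chain R (lumped_edges E)) y y',
        Ls Q (y, y') = if (y, y') \in E
                       then Q (kappa y, kappa y') * L (y, y') else 0].

Definition compatible_markov_embedding E
    (Ls : chain R (lumped_edges E) -> chain R E) : Prop :=
  exists L, embedding_induced_by L Ls.

End Lumping.

(* Main.v *)
(* Given (x, x') in D and y in S_x, lumpability says that P(y, .) has mass
   kappa_star P (x, x') > 0 on S_{x'}: so y has a neighbour in S_{x'}, and the
   quotient L(y, .) is P(y, .) conditioned on landing in S_{x'}. Multiplying L by
   kappa_star P recovers P, and multiplying it by any other chain Q on D gives a
   stochastic matrix, by summing each row block by block. *)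

Require Import Defs.
From mathcomp Require Import all_boot all_order all_algebra.
From mathcomp Require Import reals.

Import Order.TTheory GRing.Theory Num.Theory.

Local Open Scope ring_scope.

Lemma Fplus_gt0 {R : realType} {V : finType} {E : {set V * V}}
    {f : {ffun V * V -> R}} {e : V * V} :
  f \in Fplus R E -> e \in E -> 0 < f e.
Proof. by move=> /forallP/(_ e) /= fe eE; rewrite eE in fe. Qed.

Lemma Fplus_eq0 {R : realType} {V : finType} {E : {set V * V}}
    {f : {ffun V * V -> R}} {e : V * V} :
  f \in Fplus R E -> e \notin E -> f e = 0.
Proof. by move=> /forallP/(_ e) /= fe /negbTE eE; rewrite eE in fe; apply/eqP. Qed.

Lemma Fplus_ge0 {R : realType} {V : finType} {E : {set V * V}}
    {f : {ffun V * V -> R}} (e : V * V) :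
  f \in Fplus R E -> 0 <= f e.
Proof.
move=> fE; have [eE|eE] := boolP (e \in E); first exact/ltW/(Fplus_gt0 fE).
by rewrite (Fplus_eq0 fE).
Qed.

Lemma chain_Fplus {R : realType} {V : finType} {E : {set V * V}}
    (P : chain R E) : chain_fun P \in Fplus R E.
Proof. by case: P => f /= /andP[]. Qed.

Lemma chain_sum1 {R : realType} {V : finType} {E : {set V * V}}
    (P : chain R E) (u : V) : \sum_v P (u, v) = 1.
Proof. by case: P => f /= /andP[_ /forallP/(_ u)/eqP]. Qed.

Lemma lumped_edgeE {Y X : finType} (kappa : Y -> X) {E : {set Y * Y}}
    {y y' : Y} :
  (y, y') \in E -> (kappa y, kappa y') \in lumped_edges kappa E.
Proof. by move=> yE; apply/imsetP; exists (y, y'). Qed.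

Lemma sum_fibers {R : realType} {Y X : finType} (kappa : Y -> X) (f : Y -> R) :
  \sum_y f y = \sum_x \sum_(y in fiber kappa x) f y.
Proof.
rewrite (partition_big kappa xpredT) //=.
by apply: eq_bigr => x _; apply: eq_bigl => y; rewrite in_fiber.
Qed.

(** The product needs no case distinction on [E]: for [L] in [Fplus R E] it already vanishes outside
    [E]. *)
Definition embed_fun {R : realType} {Y X : finType} (kappa : Y -> X)
    (E : {set Y * Y}) (L : {ffun Y * Y -> R}) (Q : chain R (lumped_edges kappa E)) :
  {ffun Y * Y -> R} := [ffun e => Q (kappa2 kappa e) * L e].

Lemma embed_fun_stochastic {R : realType} {Y X : finType} (kappa : Y -> X)
    (E : {set Y * Y}) (L : {ffun Y * Y -> R}) (Q : chain R (lumped_edges kappa E)) :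
  L \in Fplus R E ->
  (forall y x', (kappa y, x') \in lumped_edges kappa E ->
     \sum_(y' in fiber kappa x') L (y, y') = 1) ->
  embed_fun kappa E L Q \in stochastic R E.
Proof.
move=> LE L1; apply/andP; split; apply/forallP => /=; [move=> [y y'] | move=> y].
  rewrite ffunE; case: ifPn => [yE|yE]; last by rewrite (Fplus_eq0 LE) // mulr0.
  by rewrite mulr_gt0 ?(Fplus_gt0 LE) // (Fplus_gt0 (chain_Fplus Q)) ?lumped_edgeE.
rewrite (sum_fibers kappa) -(chain_sum1 Q (kappa y)); apply/eqP/eq_bigr => x' _.
under eq_bigr => y' /[!in_fiber] /eqP y'x' do rewrite ffunE /kappa2 /= y'x'.
(* The factor from [Q] is constant on the block over [x']. The block of [L] has sum 1 only when
   [(kappa y, x')] is a lumped edge; otherwise [Q] itself is zero there. *)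
rewrite -mulr_sumr; have [xD|xD] := boolP ((kappa y, x') \in lumped_edges kappa E).
  by rewrite L1 // mulr1.
by rewrite (Fplus_eq0 (chain_Fplus Q)) // mul0r.
Qed.

(** The edge of [E] lying over [(x, x')] may start at another point of the fiber of [x]; lumpability
    carries its positive mass over to [y]. *)
Lemma lumped_edge_lift {R : realType} {Y X : finType} {kappa : Y -> X}
    {E : {set Y * Y}} {P : chain R E} (ks : surjective kappa)
    (hP : lumpable kappa P) (x x' : X) (y : Y) :
  (x, x') \in lumped_edges kappa E -> y \in fiber kappa x ->
  exists2 y', y' \in fiber kappa x' & (y, y') \in E.
Proof.
move=> xD yx; have := Fplus_gt0 (chain_Fplus (kappa_star ks hP)) xD.
rewrite /= (lump_funE hP _ yx) => sum_gt0.
have [y' /andP[y'x' yE]|no] := pickP [pred y' | (y' \in fiber kappa x') && ((y, y') \in E)].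
  by exists y'.
(* Without a neighbour of [y] in the fiber of [x'], every term of this positive sum would be
   zero. *)
move: sum_gt0; rewrite big1 ?ltxx // => y' y'x'.
by apply: (Fplus_eq0 (chain_Fplus P)); have /= := no y'; rewrite y'x' => /= ->.
Qed.

(** The denominator is zero off the lumped edges, but [P] vanishes outside [E], so the quotient is
    zero there whatever the denominator. *)
Definition cond_fun {R : realType} {Y X : finType} {kappa : Y -> X}
    {E : {set Y * Y}} {P : chain R E} (ks : surjective kappa)
    (hP : lumpable kappa P) : {ffun Y * Y -> R} :=
  [ffun e => P e / kappa_star ks hP (kappa2 kappa e)].

Lemma cond_fun_Fplus {R : realType} {Y X : finType} {kappa : Y -> X}
    {E : {set Y * Y}} {P : chain R E} (ks : surjective kappa)
    (hP : lumpable kappa P) : cond_fun ks hP \in Fplus R E.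
Proof.
apply/forallP => -[y y']; rewrite ffunE; case: ifPn => [yE|yE].
  rewrite divr_gt0 ?(Fplus_gt0 (chain_Fplus P)) //.
  by rewrite (Fplus_gt0 (chain_Fplus _)) ?lumped_edgeE.
by rewrite (Fplus_eq0 (chain_Fplus P)) // mul0r.
Qed.

(** The denominator is constant along the fiber of [x'] and, by lumpability, equals the sum of the
    numerators in row [y]. *)
Lemma cond_fun_sum1 {R : realType} {Y X : finType} {kappa : Y -> X}
    {E : {set Y * Y}} {P : chain R E} (ks : surjective kappa)
    (hP : lumpable kappa P) (y : Y) (x' : X) :
  (kappa y, x') \in lumped_edges kappa E ->
  \sum_(y' in fiber kappa x') cond_fun ks hP (y, y') = 1.
Proof.
move=> xD; have := Fplus_gt0 (chain_Fplus (kappa_star ks hP)) xD.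
under eq_bigr => y' /[!in_fiber] /eqP y'x' do rewrite ffunE /kappa2 /= y'x'.
rewrite -mulr_suml /= (lump_funE hP x' (y := y)) ?in_fiber // => s_gt0.
by rewrite divff ?gt_eqF.
Qed.

Theorem lemma4p2 (R : realType) (Y X : finType)
    (hY : (1 < #|Y|)%N) (hX : (1 < #|X|)%N)
    (E : {set Y * Y}) (hE : strongly_connected E)
    (kappa : Y -> X) (hkappa : surjective kappa)
    (P : chain R E) (hP : lumpable kappa P) :
  exists Ls : chain R (lumped_edges kappa E) -> chain R E,
    [/\ compatible_markov_embedding Ls,
        P = Ls (kappa_star hkappa hP)
      & exists L : {ffun Y * Y -> R},
          [/\ L \in Fplus R E,
              forall y y', (y, y') \in E ->
                L (y, y') = P (y, y') / kappa_star hkappa hP (kappa y, kappa y')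
            & embedding_induced_by L Ls]].
Proof.
pose L := cond_fun hkappa hP.
have LE : L \in Fplus R E by exact: cond_fun_Fplus.
have L1 := cond_fun_sum1 hkappa hP.
pose Ls Q := Chain (embed_fun_stochastic kappa E L Q LE L1).
have LLs : embedding_induced_by L Ls.
  split=> // [|y x' xD|Q y y'].
  - exact: lumped_edge_lift hkappa hP.
  - by split=> [y' _|]; [exact: Fplus_ge0 LE | rewrite L1].
  - by rewrite ffunE; case: ifPn => // yE; rewrite (Fplus_eq0 LE) // mulr0.
exists Ls; split; first by exists L.
  (* Chains are equal once their functions agree, since membership in [stochastic] is a boolean
     condition. *)
  apply/val_inj/ffunP => -[y y']; rewrite [RHS]ffunE [L _]ffunE mulrC.
  (* Cancelling the denominator requires it to be nonzero, which is ensured on [E]; elsewhere both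
     sides are zero. *)
  have [yE|yE] := boolP ((y, y') \in E).
    by rewrite divfK // gt_eqF // (Fplus_gt0 (chain_Fplus _)) ?lumped_edgeE.
  by rewrite /= (Fplus_eq0 (chain_Fplus P)) // !mul0r.
by exists L; split=> // y y' _; rewrite ffunE.
Qed.
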